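(* $\mathrm{WL}_1\not\preceq\omega^{(2)}$: there exist graphs $G$ and $H$ with $\omega^{(2)}(G)=\omega^{(2)}(H)$ but $\mathrm{WL}_1(G)\ne\mathrm{WL}_1(H)$.
   Context: Graphs are finite, simple and undirected; an $n$-vertex graph has $V(G)=\{1,\dots,n\}$. Let $w_k(x,y)$ be the number of walks of length $k$ from $x$ to $y$ and $w_*(x,y)=(w_0(x,y),\dots,w_{n-1}(x,y))$. Define vertex colorings $\omega_0(x)=w_*(x,x)$ and $\omega_{r+1}(x)=\big(\omega_r(x),\{\!\{(w_*(x,y),\omega_r(y))\}\!\}_{y\in V(G)}\big)$, with $\{\!\{\cdot\}\!\}$ a multiset, and $\omega^{(r)}(G)=\{\!\{\omega_r(x)\}\!\}_{x\in V(G)}$. Color refinement (1-WL): $C^0(x)$ uniform (or the vertex color for colored graphs), $C^{r+1}(x)=\big(C^r(x),\{\!\{C^r(y)\}\!\}_{y\in N(x)}\big)$; $\mathrm{WL}_1(G)=\{\!\{C^n(x)\}\!\}_{x\in V(G)}$. *)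

(* Defs.v *)
From mathcomp Require Import all_boot.
From mathcomp Require Import finmap multiset.
Set Implicit Arguments. Unset Strict Implicit. Unset Printing Implicit Defensive.
Local Open Scope mset_scope.

Definition simple_graph (n : nat) (g : rel 'I_n) : Prop :=
  symmetric g /\ irreflexive g.

Fixpoint walks (n : nat) (g : rel 'I_n) (k : nat) (x y : 'I_n) : nat :=
  match k with
  | 0 => (x == y : nat)
  | k'.+1 => \sum_(z : 'I_n | g x z) walks g k' z y
  end.

Definition wstar (n : nat) (g : rel 'I_n) (x y : 'I_n) : seq nat :=
  [seq walks g k x y | k <- iota 0 n].

Fixpoint omega_col (r : nat) : choiceType :=
  match r with
  | 0 => seq nat
  | r'.+1 => (omega_col r' * {mset (seq nat * omega_col r')})%type
  end.

Fixpoint omega (n : nat) (g : rel 'I_n) (r : nat) : 'I_n -> omega_col r :=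
  match r return 'I_n -> omega_col r with
  | 0 => fun x => wstar g x x
  | r'.+1 => fun x =>
      (omega g r' x,
       seq_mset [seq (wstar g x y, omega g r' y) | y <- enum 'I_n])
  end.

Definition omega_inv (n : nat) (g : rel 'I_n) (r : nat) : {mset omega_col r} :=
  seq_mset [seq omega g r x | x <- enum 'I_n].

Fixpoint wl_col (r : nat) : choiceType :=
  match r with
  | 0 => unit
  | r'.+1 => (wl_col r' * {mset wl_col r'})%type
  end.

Fixpoint wl_color (n : nat) (g : rel 'I_n) (r : nat) : 'I_n -> wl_col r :=
  match r return 'I_n -> wl_col r with
  | 0 => fun _ => tt
  | r'.+1 => fun x =>
      (wl_color g r' x,
       seq_mset [seq wl_color g r' y | y <- enum 'I_n & g x y])
  end.

Definition WL1 (n : nat) (g : rel 'I_n) : {mset wl_col n} :=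
  seq_mset [seq wl_color g n x | x <- enum 'I_n].

(* Main.v *)
(**
Take two strongly regular graphs with parameters (16,6,2,2), the 4x4 rook graph
and the Shrikhande graph, and color six vertices of each.  In a colored strongly
regular graph walk counts only see equality and adjacency, so refining a coloring
by walk counts amounts to plain color refinement; the colorings are chosen such that
color refinement separates the two graphs only after three rounds.

Colors are encoded by hanging on each vertex a rooted gadget: a complete binary tree
of depth 2 on the six colored vertices, a 4-cycle on the others.  Both have the same
number of closed walks of each length at the root (counted from the root, the last
level of the tree branches by 2 going down and by 1 going up, and conversely for the
cycle), so the gadgets do not disturb walk counts between different gadgets, up to a
factor 2 at the far vertex of a 4-cycle.  Thus [w_k(x,y)] is a function of local data
of [(x,y)], and [omega_r] of a gadget vertex is a function of its position and of the
[r]-round refined color of the root.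
*)
Require Import Defs.
From mathcomp Require Import all_boot.
From mathcomp Require Import finmap multiset.
Set Implicit Arguments. Unset Strict Implicit. Unset Printing Implicit Defensive.

Lemma eq_perm_map_key (A B : eqType) (K T : eqType) (a : A -> K) (b : B -> K)
    (u : A -> T) (v : B -> T) (s : seq A) (t : seq B) :
  (forall x y, x \in s -> y \in t -> a x = b y -> u x = v y) ->
  perm_eq (map a s) (map b t) -> perm_eq (map u s) (map v t).
Proof.
elim: s t => [|x s IHs] t uv /=; first by case: t {uv} => // ? ? /perm_size.
move=> st; have /mapP[y ty axy]: a x \in map b t by rewrite -(perm_mem st) mem_head.
have tE := perm_to_rem ty.
have /perm_trans-> : perm_eq (u x :: map u s) (map v (y :: rem y t)) => //=.
  rewrite (uv x y) ?mem_head// perm_cons IHs// => [x' y' sx' ty'|].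
    by apply: uv; rewrite ?inE ?sx' ?orbT// (mem_rem ty').
  by rewrite -(perm_cons (a x)) (perm_trans st)// axy (perm_map b tE).
by rewrite perm_sym (perm_map v tE).
Qed.

Lemma count_seq_mset (K : choiceType) (P : pred K) (s : seq K) :
  count P (seq_mset s) = count P s.
Proof. exact/permP/perm_eq_seq_mset. Qed.

(** * Base graphs with gadgets attached *)

(* Adjacency lists, numbered such that the colored vertices come first. *)
Definition rook : seq (seq nat) :=
  [:: [:: 1; 2; 3; 6; 9; 12]; [:: 0; 2; 5; 6; 7; 13]; [:: 0; 1; 6; 8; 10; 14];
      [:: 0; 4; 7; 8; 9; 12]; [:: 3; 6; 7; 8; 11; 15]; [:: 1; 7; 9; 10; 11; 13];
      [:: 0; 1; 2; 4; 11; 15]; [:: 1; 3; 4; 5; 8; 13]; [:: 2; 3; 4; 7; 10; 14];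
      [:: 0; 3; 5; 10; 11; 12]; [:: 2; 5; 8; 9; 11; 14]; [:: 4; 5; 6; 9; 10; 15];
      [:: 0; 3; 9; 13; 14; 15]; [:: 1; 5; 7; 12; 14; 15];
      [:: 2; 8; 10; 12; 13; 15]; [:: 4; 6; 11; 12; 13; 14]].

Definition shrikhande : seq (seq nat) :=
  [:: [:: 2; 8; 9; 10; 12; 13]; [:: 4; 10; 11; 13; 14; 15];
      [:: 0; 3; 5; 12; 13; 14]; [:: 2; 5; 6; 7; 13; 15]; [:: 1; 5; 8; 9; 14; 15];
      [:: 2; 3; 4; 6; 9; 14]; [:: 3; 5; 7; 9; 10; 11]; [:: 3; 6; 8; 11; 12; 15];
      [:: 0; 4; 7; 9; 12; 15]; [:: 0; 4; 5; 6; 8; 10]; [:: 0; 1; 6; 9; 11; 13];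
      [:: 1; 6; 7; 10; 12; 14]; [:: 0; 2; 7; 8; 11; 14]; [:: 0; 1; 2; 3; 10; 15];
      [:: 1; 2; 4; 5; 11; 12]; [:: 1; 3; 4; 7; 8; 13]].

Definition colored (b : nat) : bool := b < 6.

(* Position 0 is the root, 1 and 2 are its neighbors. *)
Definition gadget (c : bool) : seq (nat * nat) :=
  if c then [:: (0, 1); (0, 2); (1, 3); (1, 4); (2, 5); (2, 6)]
  else [:: (0, 1); (0, 2); (1, 3); (2, 3)].

Definition gadget_adj (c : bool) (s t : nat) : bool :=
  ((s, t) \in gadget c) || ((t, s) \in gadget c).

Definition gadget_size (c : bool) : nat := if c then 7 else 4.

Definition level (t : nat) : nat := if t is 0 then 0 else if t < 3 then 1 else 2.

Definition block (b : nat) : seq (nat * nat) :=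
  [seq (b, t) | t <- iota 0 (gadget_size (colored b))].

Definition verts : seq (nat * nat) := flatten [seq block b | b <- iota 0 16].
Arguments verts : simpl never.

Definition base_adj (e : seq (seq nat)) (b b' : nat) : bool := b' \in nth [::] e b.

Definition adj (e : seq (seq nat)) (p q : nat * nat) : bool :=
  if p.1 == q.1 then gadget_adj (colored p.1) p.2 q.2
  else [&& p.2 == 0, q.2 == 0 & base_adj e p.1 q.1].

Definition vx (x : 'I_82) : nat * nat := nth (0, 0) verts x.

Definition graph (e : seq (seq nat)) : rel 'I_82 := fun x y => adj e (vx x) (vx y).

Lemma map_vx : [seq vx x | x <- enum 'I_82] = verts.
Proof.
rewrite -[RHS](mkseq_nth (0, 0)) /mkseq -[size verts]/82 -val_enum_ord -map_comp.
exact: eq_map.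
Qed.

Lemma vx_in x : vx x \in verts.
Proof. by rewrite mem_nth. Qed.

Lemma vx_inj : injective vx.
Proof.
have u : uniq verts by vm_compute.
by move=> x y /eqP; rewrite /vx nth_uniq// => /eqP/val_inj.
Qed.

Lemma sum_vx (P : pred (nat * nat)) (F : nat * nat -> nat) :
  \sum_(x : 'I_82 | P (vx x)) F (vx x) = \sum_(p <- verts | P p) F p.
Proof. by rewrite -map_vx big_map big_enum_cond. Qed.

Lemma graph_simple e :
  all (fun p => all (fun q => adj e p q == adj e q p) verts && ~~ adj e p p) verts ->
  simple_graph (graph e).
Proof.
move=> /allP h; split=> [x y|x]; have /andP[/allP s i] := h _ (vx_in x).
  exact/eqP/s/vx_in.
exact: negbTE.
Qed.

(** * Walk counts *)

(* The data on which [w_k(p,q)] depends, up to the factor [weight p q]. *)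
Definition label := (nat * nat * bool * nat)%type.

Definition label_of (e : seq (seq nat)) (p q : nat * nat) : label :=
  (if p.1 == q.1 then (2, p.2) else (base_adj e p.1 q.1 : nat, level p.2),
   colored q.1, q.2).

Definition weight (p q : nat * nat) : nat :=
  if [&& p.1 != q.1, ~~ colored p.1 & p.2 == 3] then 2 else 1.

(* Labels of the pairs [(z,q)] for [z] a neighbor of [p], with multiplicities
   [weight z q], given the label of [(p,q)].  At the roots they come from the
   parameters (16,6,2,2): 3 = 6 - 1 - 2 and 4 = 6 - 2. *)
Definition next (l : label) : seq label :=
  let: (s, i, c, t) := l in
  match s, i with
  | 2, _ =>
      [seq (2, j, c, t) | j <- iota 0 (gadget_size c) & gadget_adj c i j]
      ++ nseq (if i is 0 then 6 else 0) (1, 0, c, t)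
  | 1, 0 => (2, 0, c, t) :: nseq 2 (1, 0, c, t) ++ nseq 3 (0, 0, c, t)
            ++ nseq 2 (1, 1, c, t)
  | _, 0 => nseq 2 (1, 0, c, t) ++ nseq 4 (0, 0, c, t) ++ nseq 2 (0, 1, c, t)
  | _, 1 => (s, 0, c, t) :: nseq 2 (s, 2, c, t)
  | _, _ => [:: (s, 1, c, t)]
  end.

Fixpoint lwalks (k : nat) (l : label) : nat :=
  match k with
  | 0 => let: (s, i, _, t) := l in (s == 2) && (i == t)
  | k'.+1 => \sum_(m <- next l) lwalks k' m
  end.

(** Certifies that the weighted walk counts satisfy the recursion of [lwalks]. *)
Definition labels_ok (e : seq (seq nat)) : bool :=
  all (fun p => let nb := [seq z <- verts | adj e p z] in
    all (fun q => perm_eq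
      (flatten [seq nseq (weight z q) (label_of e z q) | z <- nb])
      (flatten (nseq (weight p q) (next (label_of e p q))))) verts) verts.

Lemma sum_flatten_nseq (T : Type) (F : T -> nat) k (s : seq T) :
  \sum_(m <- flatten (nseq k s)) F m = k * \sum_(m <- s) F m.
Proof.
by elim: k => [|k IHk] /=; rewrite ?big_nil ?mul0n// big_cat /= IHk mulSn.
Qed.

Lemma walks_graph e k (x y : 'I_82) : labels_ok e ->
  walks (graph e) k x y = weight (vx x) (vx y) * lwalks k (label_of e (vx x) (vx y)).
Proof.
move=> eP; elim: k x => [|k IHk] x /=.
  rewrite -(inj_eq vx_inj) /label_of /weight.
  case: (vx x) (vx y) => [b s] [b' t]; rewrite xpair_eqE /=.
  case: (b == b'); rewrite ?mul1n//=.
  by case: base_adj; rewrite muln0.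
under eq_bigr => z _ do rewrite IHk.
rewrite (sum_vx (adj e (vx x))
  (fun p => weight p (vx y) * lwalks k (label_of e p (vx y)))).
have /allP/(_ _ (vx_in y)) h := allP eP _ (vx_in x).
rewrite -sum_flatten_nseq -(perm_big _ h) [RHS]big_flatten big_map big_filter /=.
by apply: eq_bigr => p _; rewrite big_nseq iter_addn_0 mulnC.
Qed.

(** * Equality of the walk-based colorings *)

(* [refined r e b] identifies the color of the base vertex [b] after [r] rounds
   of color refinement.  Colors of neighbors are encoded as numbers; [refined_ok]
   checks that this loses nothing. *)
Fixpoint refined (r : nat) (e : seq (seq nat)) (b : nat) : seq nat :=
  match r with
  | 0 => [:: colored b : nat]
  | r'.+1 => refined r' e b ++
      sort leq [seq foldr (fun i m => i + m.*2) 0 (refined r' e b') | b' <- nth [::] e b]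
  end.

Definition view (r : nat) (e : seq (seq nat)) (b b' : nat) :=
  (b == b', base_adj e b b', colored b', refined r e b').

Definition refined_ok (r : nat) (e e' : seq (seq nat)) : bool :=
  all (fun b => all (fun b' => (refined r.+1 e b == refined r.+1 e' b') ==>
    [&& colored b == colored b', refined r e b == refined r e' b'
      & perm_eq [seq view r e b d | d <- iota 0 16]
                [seq view r e' b' d | d <- iota 0 16]]) (iota 0 16)) (iota 0 16).

(** Base vertices with equal keys carry the same gadget, so their blocks match position by
    position. *)
Lemma perm_verts (K T : eqType) (a b : nat -> K) (u v : nat * nat -> T) :
  (forall d d' t, a d = b d' -> colored d = colored d' /\ u (d, t) = v (d', t)) ->
  perm_eq [seq a d | d <- iota 0 16] [seq b d | d <- iota 0 16] ->
  perm_eq (map u verts) (map v verts).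
Proof.
move=> uv ab; rewrite /verts !map_flatten -!map_comp; apply: perm_flatten.
apply: eq_perm_map_key ab => d d' _ _ ab /=.
have [cE _] := uv d d' 0 ab.
by rewrite /block -!map_comp cE; apply: eq_map => t /=; case: (uv d d' t ab).
Qed.

Lemma vx1_in x : (vx x).1 \in iota 0 16.
Proof.
have /allP : all (fun p => p.1 \in iota 0 16) verts by vm_compute.
by apply; apply: vx_in.
Qed.

Lemma omega_graph e e' R : labels_ok e -> labels_ok e' ->
  (forall r, r < R -> refined_ok r e e') ->
  forall r, r <= R -> forall x y, (vx x).2 = (vx y).2 ->
    colored (vx x).1 = colored (vx y).1 ->
    refined r e (vx x).1 = refined r e' (vx y).1 ->
  omega (graph e) r x = omega (graph e') r y.
Proof.
move=> eP e'P rP; elim=> [|r IHr] rR x y tE cE rE.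
  apply: eq_map => k; rewrite !walks_graph// /weight /label_of !eqxx/=.
  by rewrite cE tE.
have /allP/(_ _ (vx1_in y)) := allP (rP _ rR) _ (vx1_in x).
rewrite rE eqxx implyTb => /and3P[_ /eqP rE' vP].
rewrite /=; congr (_, _); first by apply: IHr => //; apply: ltnW.
apply/eq_seq_msetP.
(* Determines both the walk vector and the round-[r] color of [p]. *)
pose key d (z p : nat * nat) :=
  (weight z p, label_of d z p, refined r d p.1).
apply: (@eq_perm_map_key _ _ _ _ (key e (vx x) \o vx) (key e' (vx y) \o vx)).
  move=> z z' _ _ [wE lE cE' tE' rzE] /=; congr (_, _).
    by apply: eq_map => k; rewrite !walks_graph// wE /label_of lE cE' tE'.
  by apply: IHr => //; apply: ltnW.
rewrite (map_comp (key e _)) (map_comp (key e' _)) map_vx.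
apply: perm_verts vP => d d' t [dE aE cE' rdE].
by rewrite /key /weight /label_of /= dE aE cE' rdE cE tE.
Qed.

Lemma omega_inv_graph e e' R : labels_ok e -> labels_ok e' ->
  (forall r, r < R -> refined_ok r e e') ->
  perm_eq [seq (colored b, refined R e b) | b <- iota 0 16]
          [seq (colored b, refined R e' b) | b <- iota 0 16] ->
  omega_inv (graph e) R = omega_inv (graph e') R.
Proof.
move=> eP e'P rP pR; apply/eq_seq_msetP.
pose key d (p : nat * nat) := (colored p.1, refined R d p.1, p.2).
apply: (@eq_perm_map_key _ _ _ _ (key e \o vx) (key e' \o vx)).
  by move=> x y _ _ [cE rE tE]; apply: (omega_graph eP e'P rP).
rewrite (map_comp (key e)) (map_comp (key e')) map_vx; apply: perm_verts pR => d d' t [cE rE].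
by rewrite /key /= cE rE.
Qed.

(** * Separation by color refinement *)

(* For [vs = v1 :: v2 :: ...], the number of neighbors on which the count for
   [v2 :: ...] is [v1]; such iterated counts are determined by the color. *)
Fixpoint chain_color (vs : seq nat) (r : nat) : wl_col r -> nat :=
  match r return wl_col r -> nat with
  | 0 => fun _ => 0
  | r'.+1 => fun c : wl_col r' * multiset (wl_col r') =>
      if vs is v :: vs' then count (fun d => chain_color vs' d == v) c.2 else 0
  end.

(* The values of [chain_color vs] on all vertices, level by level to avoid
   recomputation. *)
Fixpoint chain (e : seq (seq nat)) (vs : seq nat) : seq nat :=
  if vs is v :: vs' then
    let d := zip verts (chain e vs') in
    [seq count (fun c => adj e p c.1 && (c.2 == v)) d | p <- verts]
  else nseq (size verts) 0.

Lemma chain_wl_color e vs r : size vs <= r ->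
  chain e vs = [seq chain_color vs (wl_color (graph e) r x) | x <- enum 'I_82].
Proof.
elim: vs r => [r _|v vs IHvs [//|r] sr].
  cbn [chain]; rewrite -map_vx size_map.
  by elim: (enum _) => //= x s ->; case: r.
cbn [chain]; rewrite (IHvs r sr) -map_vx zip_map -map_comp; apply: eq_map => x.
rewrite [RHS]/= count_seq_mset [RHS]count_map count_filter [LHS]/= count_map.
by apply: eq_count => y; rewrite /= andbC.
Qed.

(* The number [r] of rounds is a variable to keep the exponentially large type
   [wl_col 82] from being unfolded. *)
Lemma wl_color_chain e e' vs r : size vs <= r ->
  seq_mset [seq wl_color (graph e) r x | x <- enum 'I_82]
    = seq_mset [seq wl_color (graph e') r x | x <- enum 'I_82] ->
  perm_eq (chain e vs) (chain e' vs).
Proof.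
move=> sr /eq_seq_msetP /(perm_map (@chain_color vs r)).
by rewrite (chain_wl_color e sr) (chain_wl_color e' sr) -!map_comp.
Qed.

Lemma rook_simple : simple_graph (graph rook).
Proof. by apply: graph_simple; vm_compute. Qed.

Lemma shrikhande_simple : simple_graph (graph shrikhande).
Proof. by apply: graph_simple; vm_compute. Qed.

Lemma rook_labels : labels_ok rook.
Proof. by vm_compute. Qed.

Lemma shrikhande_labels : labels_ok shrikhande.
Proof. by vm_compute. Qed.

Lemma rook_shrikhande_refined r : r < 2 -> refined_ok r rook shrikhande.
Proof. by case: r => [|[|//]] _; vm_compute. Qed.

Lemma rook_shrikhande_perm :
  perm_eq [seq (colored b, refined 2 rook b) | b <- iota 0 16]
          [seq (colored b, refined 2 shrikhande b) | b <- iota 0 16].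
Proof. by vm_compute. Qed.

(* The sequence was found by computer search. *)
Lemma rook_shrikhande_chain :
  ~~ perm_eq (chain rook [:: 2; 0; 1; 0; 2; 0]) (chain shrikhande [:: 2; 0; 1; 0; 2; 0]).
Proof. by vm_compute. Qed.

Theorem theorem6p2 :
  exists (n : nat) (G H : rel 'I_n),
    [/\ simple_graph G, simple_graph H,
        omega_inv G 2 = omega_inv H 2
      & WL1 G <> WL1 H].
Proof.
exists 82, (graph rook), (graph shrikhande); split.
- exact: rook_simple.
- exact: shrikhande_simple.
- exact: (omega_inv_graph rook_labels shrikhande_labels rook_shrikhande_refined
            rook_shrikhande_perm).
- move=> WLE; have /negP := rook_shrikhande_chain; apply.
  (* The chain has length 6, within the 82 rounds. *)
  by apply: (@wl_color_chain _ _ _ 82) WLE.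
Qed.
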